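(* Let $\mathbb{H}=\{w\in\mathbb{C}:\operatorname{Im} w>0\}$ and let $S:\mathbb{H}\to\mathbb{C}$ be the function $S(w)=F(w)+G(w)$, where $F(w)=\sum_{n=0}^{\infty}e(2^n w)$ and $G(w)=\sum_{l=1}^{\infty}e\left(-\frac{1}{2^l}\right)\left(e\left(\frac{w}{2^l}\right)-1\right)$. Then $V:=S(\mathbb{H})=\mathbb{C}$, that is, the function $S$ attains every complex value on $\mathbb{H}$.
   Context: Notation: $e(w)=\exp(2\pi i w)$ for $w\in\mathbb{C}$. The series $F$ converges on $\mathbb{H}$ and defines a holomorphic function there. The series $G$ converges uniformly on compact subsets of $\mathbb{C}$ and defines an entire function. Hence $S$ is holomorphic on $\mathbb{H}$. *)

(* Defs.v *)
From Stdlib Require Import Reals Lra Lia.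
From Coquelicot Require Import Coquelicot.
Open Scope R_scope.
Open Scope C_scope.

Definition Cexp (z : C) : C :=
  ((exp (Re z) * cos (Im z))%R, (exp (Re z) * sin (Im z))%R).

Definition e (w : C) : C := Cexp (2 * PI * Ci * w).

(* The sum of a complex series: the unique [l] with [is_series a l] if there
   is one (see [is_series_CSeries]), unspecified otherwise. *)
Definition CSeries (a : nat -> C) : C :=
  @iota C_CompleteNormedModule (fun l : C => is_series a l).

Definition upper_half_plane (w : C) : Prop := (0 < Im w)%R.

Definition F_term (w : C) (n : nat) : C := e (2 ^ n * w).

(* The series starts at [l = 1], so the term of index [k] is that of
   [l = S k]. *)
Definition G_term (w : C) (k : nat) : C :=
  let l := S k in e (- (1 / 2 ^ l)) * (e (w / 2 ^ l) - 1).

Definition F (w : C) : C := CSeries (F_term w).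

Definition G (w : C) : C := CSeries (G_term w).

(* The function called S in the mathematics ([S] is the successor on [nat]).
   It is total here, but only meaningful on the upper half plane, where both
   series converge (see [ex_series_F_term] and [ex_series_G_term]). *)
Definition S_fun (w : C) : C := F w + G w.

Lemma is_series_CSeries (a : nat -> C) (l : C) :
  is_series a l -> CSeries a = l.
Proof.
intros H; unfold CSeries.
apply (@iota_filterlim_locally C_AbsRing C_CompleteNormedModule nat eventually
  (Proper_StrongProper _ _) (sum_n a) l H).
Qed.

Lemma Cmod_Cexp (z : C) : Cmod (Cexp z) = exp (Re z).
Proof.
unfold Cexp, Cmod; simpl fst; simpl snd.
replace ((exp (Re z) * cos (Im z)) ^ 2 + (exp (Re z) * sin (Im z)) ^ 2)%R
  with (Rsqr (exp (Re z)) * (Rsqr (sin (Im z)) + Rsqr (cos (Im z))))%R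
  by (unfold Rsqr; ring).
rewrite sin2_cos2, Rmult_1_r; apply sqrt_Rsqr, Rlt_le, exp_pos.
Qed.

Lemma Cmod_e (w : C) : Cmod (e w) = exp (- (2 * PI * Im w)).
Proof.
unfold e; rewrite Cmod_Cexp; f_equal.
destruct w as [x y]; unfold Re, Im, Cmult, Ci, RtoC; simpl; ring.
Qed.

Lemma ex_series_F_term (w : C) : upper_half_plane w -> ex_series (F_term w).
Proof.
unfold upper_half_plane; intros Hw.
assert (Hpi := PI_RGT_0).
set (c := (2 * PI * Im w)%R).
assert (Hc : (0 < c)%R) by (unfold c; nra).
apply (@ex_series_le C_AbsRing C_CompleteNormedModule _
  (fun n => exp (- c) ^ n)%R).
- intros n; change (Cmod (F_term w n) <= exp (- c) ^ n)%R.
  unfold F_term; rewrite Cmod_e, <- RtoC_pow, im_scal_l.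
  assert (E : (exp (- c) ^ n = exp (- c * INR n))%R).
  { rewrite <- Rpower_pow by apply exp_pos; unfold Rpower.
    rewrite ln_exp; f_equal; ring. }
  rewrite E.
  assert (Hn : (INR n <= 2 ^ n)%R).
  { clear E; induction n as [|n IH]; [simpl; lra|].
    rewrite S_INR; simpl pow.
    assert (1 <= 2 ^ n)%R by (apply pow_R1_Rle; lra); lra. }
  assert (H : (- (2 * PI * (2 ^ n * Im w)) <= - c * INR n)%R)
    by (unfold c in *; nra).
  destruct H as [H|H]; [left; now apply exp_increasing|right; now rewrite H].
- apply ex_series_geom; rewrite Rabs_pos_eq by (left; apply exp_pos).
  rewrite <- exp_0; apply exp_increasing; lra.
Qed.

Lemma Rabs_sin_le (y : R) : (Rabs (sin y) <= Rabs y)%R.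
Proof.
destruct (MVT_abs sin cos 0 y) as [t [Ht _]].
- intros; apply derivable_pt_lim_sin.
- rewrite sin_0, !Rminus_0_r in Ht; rewrite Ht.
  assert (H := Rabs_pos y); assert (Rabs (cos t) <= 1)%R; [|nra].
  apply Rabs_le; generalize (COS_bound t); lra.
Qed.

Lemma Rabs_cos_1_le (y : R) : (Rabs (cos y - 1) <= Rabs y)%R.
Proof.
destruct (MVT_abs cos (fun t => - sin t)%R 0 y) as [t [Ht _]].
- intros; apply derivable_pt_lim_cos.
- rewrite cos_0, Rminus_0_r in Ht; rewrite Ht.
  assert (H := Rabs_pos y); assert (Rabs (- sin t) <= 1)%R; [|nra].
  apply Rabs_le; generalize (SIN_bound t); lra.
Qed.

Lemma Rabs_exp_1_le (x : R) : (Rabs (exp x - 1) <= Rabs x * exp (Rabs x))%R.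
Proof.
destruct (MVT_abs exp exp 0 x) as [t [Ht Hb]].
- intros; apply derivable_pt_lim_exp.
- rewrite exp_0, Rminus_0_r in Ht; rewrite Ht, Rmult_comm.
  apply Rmult_le_compat_l; [apply Rabs_pos|].
  rewrite Rabs_pos_eq by (left; apply exp_pos).
  assert (H : (t <= Rabs x)%R).
  { revert Hb; unfold Rmin, Rmax, Rabs.
    destruct (Rle_dec 0 x); destruct (Rcase_abs x); lra. }
  destruct H as [H|H]; [left; now apply exp_increasing|right; now rewrite H].
Qed.

Lemma Cmod_Cexp_1_le (z : C) :
  (Cmod (Cexp z - 1) <= Rabs (Re z) * exp (Rabs (Re z)) + 2 * Rabs (Im z))%R.
Proof.
set (u := (cos (Im z), sin (Im z)) : C).
assert (Hu : Cmod u = 1%R).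
{ replace u with (Cexp (0%R, Im z)).
  - rewrite Cmod_Cexp; simpl; apply exp_0.
  - unfold u, Cexp; simpl; rewrite exp_0, !Rmult_1_l; reflexivity. }
replace (Cexp z - 1) with
  ((exp (Re z) - 1)%R * u + ((cos (Im z) - 1)%R + sin (Im z) * Ci)).
2: { unfold Cexp, u, Cplus, Cmult, Cminus, Copp, RtoC, Ci.
     apply injective_projections; simpl; ring. }
eapply Rle_trans; [apply Cmod_triangle|].
rewrite Cmod_mult, Hu, Rmult_1_r, Cmod_R.
apply Rplus_le_compat; [apply Rabs_exp_1_le|].
eapply Rle_trans; [apply Cmod_triangle|].
rewrite Cmod_mult, !Cmod_R.
replace (Cmod Ci) with 1%R.
- generalize (Rabs_sin_le (Im z)) (Rabs_cos_1_le (Im z)); lra.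
- unfold Cmod, Ci; simpl.
  replace (0 * (0 * 1) + 1 * (1 * 1))%R with 1%R by ring.
  symmetry; apply sqrt_1.
Qed.

Lemma ex_series_G_term (w : C) : ex_series (G_term w).
Proof.
set (z := 2 * PI * Ci * w).
set (M := (Rabs (Re z) * exp (Rabs (Re z)) + 2 * Rabs (Im z))%R).
apply (@ex_series_le C_AbsRing C_CompleteNormedModule _
  (fun n => scal M ((/ 2) ^ n)%R)).
- intros n; change (Cmod (G_term w n) <= M * (/ 2) ^ n)%R.
  assert (Hp : (0 < (/ 2) ^ S n <= 1)%R).
  { split; [apply pow_lt; lra|].
    rewrite pow_inv, <- Rinv_1; apply Rinv_le_contravar; [lra|].
    apply pow_R1_Rle; lra. }
  assert (Hn : (0 < (/ 2) ^ n)%R) by (apply pow_lt; lra).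
  assert (E : / 2 ^ S n = RtoC ((/ 2) ^ S n)).
  { rewrite pow_inv, RtoC_inv, RtoC_pow; [reflexivity|].
    apply pow_nonzero; lra. }
  unfold G_term, Cdiv; rewrite Cmod_mult, Cmod_e, E.
  replace (Im (- (1 * RtoC ((/ 2) ^ S n)))) with 0%R
    by (unfold Im, Copp, Cmult, RtoC; simpl; ring).
  rewrite Rmult_0_r, Ropp_0, exp_0, Rmult_1_l.
  unfold e.
  replace (2 * PI * Ci * (w * RtoC ((/ 2) ^ S n)))
    with (RtoC ((/ 2) ^ S n) * z) by (unfold z; ring).
  eapply Rle_trans; [apply Cmod_Cexp_1_le|].
  rewrite re_scal_l, im_scal_l, !Rabs_mult.
  rewrite (Rabs_pos_eq ((/ 2) ^ S n)) by lra.
  unfold M; generalize (Rabs_pos (Re z)) (Rabs_pos (Im z)).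
  set (a := Rabs (Re z)); set (b := Rabs (Im z)); intros Ha Hb.
  assert (Hq : ((/ 2) ^ S n <= (/ 2) ^ n)%R) by (simpl; lra).
  set (p := ((/ 2) ^ S n)%R) in *; set (q := ((/ 2) ^ n)%R) in *.
  assert (H : (exp (p * a) <= exp a)%R).
  { assert (H : (p * a <= a)%R) by nra.
    destruct H as [H|H]; [left; now apply exp_increasing|right; now rewrite H]. }
  assert (H0 := exp_pos (p * a)).
  assert (H1 : (p * a * exp (p * a) <= q * a * exp a)%R)
    by (apply Rmult_le_compat; nra).
  nra.
- apply (@ex_series_scal R_AbsRing R_NormedModule M).
  apply ex_series_geom; rewrite Rabs_pos_eq; lra.
Qed.

(* Main.v *)
(** Put H(u) = sum_(l >= 1) (e(u / 2^l) - 1) and T = F + H, so that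
    S(u + 1) = T(u) - H(-1). The two halves telescope: T(2u) = T(u) - 1, and
    H(2u) = H(u) + e(u) - 1 gives, for an integer m,
    T(u + 2^k m) - T(u) = H(u / 2^k + m) - H(u / 2^k), which tends to H(m) as
    k grows. Hence the image of T is, up to small errors, stable under
    translation by the closed semigroup generated by 1, -1 and all H(m).
    This semigroup is a group: H(m) + H(-m) is real because H(-m) is the
    conjugate of H(m), and a closed additive subsemigroup of R containing Z is
    a group by recurrence on R / Z. It contains
    H(n + 2^-k) - H(n) - H(2^-k) = sum_l (e(n / 2^l) - 1) (e(2^-k / 2^l) - 1),
    which tends to 0 and has positive real part for n = -1 and negative
    imaginary part for n = 1; with conjugates, this makes it all of C. The
    errors are removed by a contraction argument near u = i, where T' <> 0;
    for this the translations are approximated with control on slopes. *)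

Require Import Defs.
From Stdlib Require Import Reals ZArith Lra Lia.
From Coquelicot Require Import Coquelicot.
Open Scope C_scope.

(** * Complex series and the complex exponential *)

Lemma C_ext (x y : C) : Re x = Re y -> Im x = Im y -> x = y.
Proof. exact (injective_projections x y). Qed.

Ltac C_coords :=
  apply C_ext; unfold Cexp, Cminus, Cplus, Cmult, Copp, Cconj, Ci, RtoC, Re, Im;
  simpl.

Lemma Cmod_minus_sym (x y : C) : Cmod (x - y) = Cmod (y - x).
Proof. rewrite <- Cmod_opp; f_equal; ring. Qed.

Lemma Cmod_le_abs_Re_Im (z : C) : (Cmod z <= Rabs (Re z) + Rabs (Im z))%R.
Proof.
replace z with (RtoC (Re z) + RtoC (Im z) * Ci) at 1 by (C_coords; ring).
eapply Rle_trans; [apply Cmod_triangle|].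
rewrite Cmod_mult, !Cmod_R, Cmod_Ci; lra.
Qed.

Lemma Rabs_Im_le_Cmod (z : C) : (Rabs (Im z) <= Cmod z)%R.
Proof.
eapply Rle_trans; [apply Rmax_r|apply (Rmax_Cmod z)].
Qed.

Lemma is_series_C_approx (a : nat -> C) (l : C) :
  is_series a l ->
  forall eps : R, (0 < eps)%R ->
  exists N : nat, forall n, (N <= n)%nat -> (Cmod (sum_n a n - l) < eps)%R.
Proof.
intros H eps Heps.
destruct (H _ (locally_ball_norm l (mkposreal eps Heps))) as [N HN].
exists N; intros n Hn; exact (HN n Hn).
Qed.

Lemma is_series_C_unique (a : nat -> C) (l l' : C) :
  is_series a l -> is_series a l' -> l = l'.
Proof.
intros H H'; rewrite <- (is_series_CSeries a l H).
now apply is_series_CSeries.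
Qed.

Lemma ex_series_C_dominated (a : nat -> C) (M : R) :
  (forall n, (Cmod (a n) <= M * (/ 2) ^ n)%R) -> exists l : C, is_series a l.
Proof.
intros H.
apply (@ex_series_le C_AbsRing C_CompleteNormedModule a
  (fun n => scal M ((/ 2) ^ n)%R) H).
apply (@ex_series_scal R_AbsRing R_NormedModule M).
apply ex_series_geom; rewrite Rabs_pos_eq; lra.
Qed.

Lemma Cmod_sum_n_dominated (a : nat -> C) (M : R) (n : nat) :
  (forall k, (Cmod (a k) <= M * (/ 2) ^ k)%R) ->
  (Cmod (sum_n a n) <= M * (2 - (/ 2) ^ n))%R.
Proof.
intros H; induction n as [|n IH].
- rewrite sum_O; specialize (H 0%nat); simpl in *; lra.
- rewrite sum_Sn; eapply Rle_trans; [apply (Cmod_triangle (sum_n a n))|].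
  specialize (H (S n)); simpl in *; lra.
Qed.

Lemma Cmod_series_dominated (a : nat -> C) (l : C) (M : R) :
  is_series a l -> (forall n, (Cmod (a n) <= M * (/ 2) ^ n)%R) ->
  (Cmod l <= 2 * M)%R.
Proof.
intros Hl H; apply le_epsilon; intros eps Heps.
destruct (is_series_C_approx a l Hl eps Heps) as [N HN].
specialize (HN N (le_n N)).
assert (HS := Cmod_sum_n_dominated a M N H).
assert (HM := H 0%nat); simpl in HM; assert (H0 := Cmod_ge_0 (a 0%nat)).
assert (0 < (/ 2) ^ N)%R by (apply pow_lt; lra).
replace l with (sum_n a N - (sum_n a N - l)) by ring.
eapply Rle_trans; [apply Cmod_triangle|]; rewrite Cmod_opp; nra.
Qed.

Lemma Re_sum_n_ge (a : nat -> C) (n : nat) (k : nat) :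
  (forall j, (0 <= Re (a j))%R) -> (k <= n)%nat ->
  (Re (a k) <= Re (sum_n a n))%R.
Proof.
intros H; revert k; induction n as [|n IH]; intros k Hk.
- replace k with 0%nat by lia; rewrite sum_O; lra.
- rewrite sum_Sn.
  assert (E : Re (plus (sum_n a n) (a (S n)))
              = (Re (sum_n a n) + Re (a (S n)))%R) by reflexivity.
  rewrite E; destruct (Nat.eq_dec k (S n)) as [->|Hne].
  + assert (H0 := IH 0%nat ltac:(lia)); assert (H1 := H 0%nat); lra.
  + assert (H0 := IH k ltac:(lia)); assert (H1 := H (S n)); lra.
Qed.

(** With nonnegative real parts, a single strictly positive term makes the real part of the sum
    strictly positive. *)
Lemma Re_series_ge (a : nat -> C) (l : C) (k : nat) :
  is_series a l -> (forall j, (0 <= Re (a j))%R) -> (Re (a k) <= Re l)%R.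
Proof.
intros Hl H; apply le_epsilon; intros eps Heps.
destruct (is_series_C_approx a l Hl eps Heps) as [N HN].
specialize (HN (max N k) (Nat.le_max_l _ _)).
assert (HS := Re_sum_n_ge a (max N k) k H (Nat.le_max_r _ _)).
assert (HR := re_le_Cmod (sum_n a (max N k) - l)).
assert (E : Re (sum_n a (max N k) - l) = (Re (sum_n a (max N k)) - Re l)%R)
  by reflexivity.
rewrite E in HR; apply Rabs_le_between in HR; lra.
Qed.

Lemma is_series_C_ext (a b : nat -> C) (l : C) :
  (forall n, a n = b n) -> is_series a l -> is_series b l.
Proof. exact (@is_series_ext C_AbsRing C_NormedModule a b l). Qed.

Lemma is_series_C_minus (a b : nat -> C) (la lb : C) :
  is_series a la -> is_series b lb ->
  is_series (fun n => a n - b n) (la - lb).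
Proof. exact (@is_series_minus C_AbsRing C_NormedModule a b la lb). Qed.

Lemma is_series_C_scal (c : C) (a : nat -> C) (l : C) :
  is_series a l -> is_series (fun n => c * a n) (c * l).
Proof. exact (@is_series_scal C_AbsRing C_NormedModule c a l). Qed.

Lemma is_series_C_shift (a : nat -> C) (l : C) :
  is_series a l -> is_series (fun n => a (S n)) (l - a 0%nat).
Proof.
intros H; apply (@is_series_incr_1 C_AbsRing C_NormedModule a).
assert (E : l = l - a 0%nat + a 0%nat) by ring.
rewrite E in H; exact H.
Qed.

Lemma sum_n_conj (a : nat -> C) (n : nat) :
  sum_n (fun k => Cconj (a k)) n = Cconj (sum_n a n).
Proof.
induction n as [|n IH]; [now rewrite !sum_O|].
rewrite !sum_Sn, IH; symmetry; apply Cplus_conj.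
Qed.

Lemma is_series_C_conj (a : nat -> C) (l : C) :
  is_series a l -> is_series (fun n => Cconj (a n)) (Cconj l).
Proof.
intros H P HP.
destruct (@locally_norm_le_locally C_AbsRing C_NormedModule _ P HP) as [eps He].
destruct (is_series_C_approx a l H eps (cond_pos eps)) as [N HN].
exists N; intros n Hn; apply He; rewrite sum_n_conj.
change (Cmod (Cconj (sum_n a n) - Cconj l) < eps)%R.
rewrite <- Cminus_conj, Cmod_conj; now apply HN.
Qed.

(** * Increments of the complex exponential *)

Lemma Cexp_plus (z w : C) : Cexp (z + w) = Cexp z * Cexp w.
Proof.
C_coords; rewrite exp_plus, ?cos_plus, ?sin_plus; ring.
Qed.

Lemma Cexp_conj (z : C) : Cexp (Cconj z) = Cconj (Cexp z).
Proof. C_coords; rewrite ?cos_neg, ?sin_neg; ring. Qed.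

(* The real mean value theorem is applied to each coordinate, hence the
   factor 2. *)
Lemma Cmod_increment_le (f df : R -> C) (M : R) :
  (forall t, (0 <= t <= 1)%R ->
     is_derive (fun s => Re (f s)) t (Re (df t)) /\
     is_derive (fun s => Im (f s)) t (Im (df t)) /\
     (Cmod (df t) <= M)%R) ->
  (Cmod (f 1%R - f 0%R) <= 2 * M)%R.
Proof.
intros H.
assert (HR : forall g dg : R -> R,
  (forall t, (0 <= t <= 1)%R -> is_derive g t (dg t) /\ (Rabs (dg t) <= M)%R)
  -> (Rabs (g 1 - g 0) <= M)%R).
{ intros g dg Hg.
  destruct (MVT_gen g 0 1 dg) as [t [Ht E]];
    rewrite ?Rmin_left, ?Rmax_right in * by lra.
  - intros x Hx; apply Hg; lra.
  - intros x Hx; apply derivable_continuous_pt.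
    exists (dg x); apply is_derive_Reals, Hg; lra.
  - rewrite E, Rminus_0_r, Rmult_1_r; now apply Hg. }
eapply Rle_trans; [apply Cmod_le_abs_Re_Im|].
assert (H1 := HR (fun s => Re (f s)) (fun s => Re (df s))).
assert (H2 := HR (fun s => Im (f s)) (fun s => Im (df s))).
change (Re (f 1%R - f 0%R)) with (Re (f 1%R) - Re (f 0%R))%R.
change (Im (f 1%R - f 0%R)) with (Im (f 1%R) - Im (f 0%R))%R.
cut (Rabs (Re (f 1%R) - Re (f 0%R)) <= M
     /\ Rabs (Im (f 1%R) - Im (f 0%R)) <= M)%R; [lra|].
split; [apply H1|apply H2]; intros t Ht; destruct (H t Ht) as [Ha [Hb Hc]].
- split; [assumption|]; eapply Rle_trans; [apply re_le_Cmod|assumption].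
- split; [assumption|]; eapply Rle_trans; [apply Rabs_Im_le_Cmod|assumption].
Qed.

Lemma exp_le (x y : R) : (x <= y)%R -> (exp x <= exp y)%R.
Proof.
intros [H|H]; [left; now apply exp_increasing|right; now rewrite H].
Qed.

(** The slope [c] is free: [c = 0] serves the Lipschitz bound, and the exponential of a centre
    serves the second-order bound. *)
Lemma Cexp_segment_derive (z w c : C) (t : R) :
  is_derive (fun s => Re (Cexp (w + RtoC s * (z - w)) - c * (RtoC s * (z - w))))
    t (Re ((Cexp (w + RtoC t * (z - w)) - c) * (z - w))) /\
  is_derive (fun s => Im (Cexp (w + RtoC s * (z - w)) - c * (RtoC s * (z - w))))
    t (Im ((Cexp (w + RtoC t * (z - w)) - c) * (z - w))).
Proof.
destruct z as [z1 z2], w as [w1 w2], c as [c1 c2].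
unfold Re, Im, Cexp, Cminus, Cplus, Cmult, Copp, RtoC; simpl.
split; auto_derive; trivial; unfold Rminus; ring.
Qed.

Lemma Re_segment_le (z w : C) (B t : R) :
  (Re z <= B)%R -> (Re w <= B)%R -> (0 <= t <= 1)%R ->
  (Re (w + RtoC t * (z - w)) <= B)%R.
Proof.
destruct z as [z1 z2], w as [w1 w2]; unfold Re; simpl; nra.
Qed.

Lemma Cmod_Cexp_minus_le (z w : C) (B : R) :
  (Re z <= B)%R -> (Re w <= B)%R ->
  (Cmod (Cexp z - Cexp w) <= 2 * exp B * Cmod (z - w))%R.
Proof.
intros Hz Hw.
set (f := fun s : R => Cexp (w + RtoC s * (z - w)) - 0 * (RtoC s * (z - w))).
replace (Cexp z - Cexp w) with (f 1%R - f 0%R).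
2: { unfold f; replace (w + 1 * (z - w)) with z by ring.
     replace (w + 0 * (z - w)) with w by ring; ring. }
rewrite Rmult_assoc.
apply (Cmod_increment_le f (fun t => (Cexp (w + RtoC t * (z - w)) - 0) * (z - w))).
intros t Ht; destruct (Cexp_segment_derive z w 0 t) as [H1 H2].
split; [exact H1|split; [exact H2|]].
rewrite Cmod_mult; apply Rmult_le_compat_r; [apply Cmod_ge_0|].
replace (Cexp (w + RtoC t * (z - w)) - 0) with (Cexp (w + RtoC t * (z - w)))
  by ring.
rewrite Cmod_Cexp; now apply exp_le, Re_segment_le.
Qed.

(** Along the segment the remainder has derivative [(Cexp _ - Cexp c) * (z - w)], whose first factor
    the Lipschitz bound makes at most [2 * exp B * r]. The centre [c] may lie off the segment, so
    the linearization error at [c] is itself Lipschitz with a small constant. *)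
Lemma Cmod_Cexp_taylor_le (z w c : C) (B r : R) :
  (Re z <= B)%R -> (Re w <= B)%R -> (Re c <= B)%R ->
  (Cmod (z - c) <= r)%R -> (Cmod (w - c) <= r)%R ->
  (Cmod (Cexp z - Cexp w - Cexp c * (z - w))
     <= 4 * exp B * r * Cmod (z - w))%R.
Proof.
intros Hz Hw Hc Hzc Hwc.
set (f := fun s : R =>
  Cexp (w + RtoC s * (z - w)) - Cexp c * (RtoC s * (z - w))).
replace (Cexp z - Cexp w - Cexp c * (z - w)) with (f 1%R - f 0%R).
2: { unfold f; replace (w + 1 * (z - w)) with z by ring.
     replace (w + 0 * (z - w)) with w by ring; ring. }
replace (4 * exp B * r * Cmod (z - w))%R
  with (2 * (2 * exp B * r * Cmod (z - w)))%R by ring.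
apply (Cmod_increment_le f
  (fun t => (Cexp (w + RtoC t * (z - w)) - Cexp c) * (z - w))).
intros t Ht; destruct (Cexp_segment_derive z w (Cexp c) t) as [H1 H2].
split; [exact H1|split; [exact H2|]].
rewrite Cmod_mult; apply Rmult_le_compat_r; [apply Cmod_ge_0|].
eapply Rle_trans.
- apply (Cmod_Cexp_minus_le _ _ B); [now apply Re_segment_le|assumption].
- apply Rmult_le_compat_l; [assert (H0 := exp_pos B); lra|].
  replace (w + RtoC t * (z - w) - c)
    with (RtoC (1 - t) * (w - c) + RtoC t * (z - c))
    by (rewrite RtoC_minus; ring).
  eapply Rle_trans; [apply Cmod_triangle|].
  rewrite !Cmod_mult, !Cmod_R, !Rabs_pos_eq by lra; nra.
Qed.

(** * The function T *)

Lemma Cexp_0 : Cexp 0 = 1.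
Proof. C_coords; rewrite exp_0, ?cos_0, ?sin_0; ring. Qed.

Lemma e_plus (z w : C) : e (z + w) = e z * e w.
Proof. unfold e; rewrite <- Cexp_plus; f_equal; ring. Qed.

Lemma e_0 : e 0 = 1.
Proof. unfold e; rewrite Cmult_0_r; apply Cexp_0. Qed.

Lemma e_1 : e 1 = 1.
Proof.
unfold e; replace (2 * PI * Ci * 1) with (0%R, (2 * PI)%R) by (C_coords; ring).
C_coords; rewrite exp_0, ?cos_2PI, ?sin_2PI; ring.
Qed.

Lemma e_IZR (m : Z) : e (RtoC (IZR m)) = 1.
Proof.
induction m as [|m IH|m IH] using Z.peano_ind.
- apply e_0.
- rewrite succ_IZR, RtoC_plus, e_plus, IH, e_1; ring.
- rewrite <- IH; unfold Z.pred; rewrite plus_IZR, RtoC_plus, e_plus.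
  replace (e (RtoC (-1))) with (RtoC 1); [ring|].
  rewrite <- e_0; replace (RtoC 0) with (RtoC (-1) + RtoC 1)
    by (rewrite <- RtoC_plus; f_equal; ring).
  rewrite e_plus, e_1; ring.
Qed.

Lemma e_plus_IZR (w : C) (m : Z) : e (w + RtoC (IZR m)) = e w.
Proof. rewrite e_plus, e_IZR; ring. Qed.

Lemma e_conj (w : C) : e (- Cconj w) = Cconj (e w).
Proof.
unfold e; rewrite <- Cexp_conj; f_equal; C_coords; ring.
Qed.

Lemma e_RtoC (x : R) : e (RtoC x) = (cos (2 * PI * x), sin (2 * PI * x))%R.
Proof.
unfold e; replace (2 * PI * Ci * x) with (0%R, (2 * PI * x)%R)
  by (C_coords; ring).
C_coords; rewrite exp_0; ring.
Qed.

Lemma Cmod_two_pi_i : Cmod (2 * PI * Ci) = (2 * PI)%R.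
Proof.
assert (H := PI_RGT_0).
rewrite !Cmod_mult, Cmod_Ci, !Cmod_R, !Rabs_pos_eq by lra; ring.
Qed.

Lemma Cmod_e_scal_minus_le (u v : C) (x B : R) :
  (0 <= x)%R -> (- B <= x * Im u)%R -> (- B <= x * Im v)%R ->
  (Cmod (e (RtoC x * u) - e (RtoC x * v))
     <= 4 * PI * exp (2 * PI * B) * x * Cmod (u - v))%R.
Proof.
intros Hx Hu Hv; assert (Hpi := PI_RGT_0); unfold e.
eapply Rle_trans; [apply (Cmod_Cexp_minus_le _ _ (2 * PI * B))|].
- replace (Re (2 * PI * Ci * (RtoC x * u))) with (- (2 * PI * (x * Im u)))%R
    by (destruct u; unfold Re, Im; simpl; ring).
  nra.
- replace (Re (2 * PI * Ci * (RtoC x * v))) with (- (2 * PI * (x * Im v)))%R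
    by (destruct v; unfold Re, Im; simpl; ring).
  nra.
- replace (2 * PI * Ci * (RtoC x * u) - 2 * PI * Ci * (RtoC x * v))
    with (2 * PI * Ci * (RtoC x * (u - v))) by ring.
  rewrite Cmod_mult, Cmod_two_pi_i, Cmod_mult, Cmod_R, Rabs_pos_eq by lra.
  right; ring.
Qed.

Lemma Cmod_e_scal_taylor_le (u v c : C) (x b r : R) :
  (0 <= x)%R -> (b <= Im u)%R -> (b <= Im v)%R -> (b <= Im c)%R ->
  (Cmod (u - c) <= r)%R -> (Cmod (v - c) <= r)%R ->
  (Cmod (e (RtoC x * u) - e (RtoC x * v)
         - 2 * PI * Ci * RtoC x * e (RtoC x * c) * (u - v))
     <= 16 * PI ^ 2 * exp (- (2 * PI * b * x)) * x ^ 2 * r * Cmod (u - v))%R.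
Proof.
intros Hx Hu Hv Hc Huc Hvc; assert (Hpi := PI_RGT_0); unfold e.
assert (HRe : forall w, (b <= Im w)%R ->
  (Re (2 * PI * Ci * (RtoC x * w)) <= - (2 * PI * b * x))%R).
{ intros w Hw.
  replace (Re (2 * PI * Ci * (RtoC x * w))) with (- (2 * PI * (x * Im w)))%R
    by (destruct w; unfold Re, Im; simpl; ring).
  assert (x * b <= x * Im w)%R by (apply Rmult_le_compat_l; assumption).
  nra. }
assert (HD : forall w w', 2 * PI * Ci * (RtoC x * w) - 2 * PI * Ci * (RtoC x * w')
  = 2 * PI * Ci * (RtoC x * (w - w'))) by (intros; ring).
assert (HM : forall w, Cmod (2 * PI * Ci * (RtoC x * w))
  = (2 * PI * x * Cmod w)%R).
{ intros w.
  rewrite Cmod_mult, Cmod_two_pi_i, Cmod_mult, Cmod_R, Rabs_pos_eq by lra.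
  ring. }
assert (HR : forall w, (Cmod (w - c) <= r)%R ->
  (Cmod (2 * PI * Ci * (RtoC x * w) - 2 * PI * Ci * (RtoC x * c))
   <= 2 * PI * x * r)%R).
{ intros w Hw; rewrite HD, HM; apply Rmult_le_compat_l; [nra|assumption]. }
replace (2 * PI * Ci * RtoC x * Cexp (2 * PI * Ci * (RtoC x * c)) * (u - v))
  with (Cexp (2 * PI * Ci * (RtoC x * c))
        * (2 * PI * Ci * (RtoC x * u) - 2 * PI * Ci * (RtoC x * v))) by ring.
eapply Rle_trans;
  [apply (Cmod_Cexp_taylor_le _ _ _ (- (2 * PI * b * x)) (2 * PI * x * r)); auto|].
rewrite HD, HM; right; ring.
Qed.

(** * The entire series H and its doubling equation *)

Definition half_pow (k : nat) : R := ((/ 2) ^ k)%R.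

Lemma half_pow_S (k : nat) : half_pow (S k) = (/ 2 * half_pow k)%R.
Proof. reflexivity. Qed.

Lemma half_pow_bounds (k : nat) : (0 < half_pow k <= 1)%R.
Proof.
induction k as [|k IH]; [unfold half_pow; simpl; lra|].
rewrite half_pow_S; lra.
Qed.

Lemma half_double (u : C) : u = 2 * (RtoC (/ 2) * u).
Proof.
rewrite Cmult_assoc, <- RtoC_mult, Rinv_r by lra; ring.
Qed.

Lemma half_pow_S_double (k : nat) (u : C) :
  RtoC (half_pow (S k)) * (2 * u) = RtoC (half_pow k) * u.
Proof.
rewrite half_pow_S, RtoC_mult, (half_double (RtoC (half_pow k) * u)); ring.
Qed.

(** The series starts at l = 1, so index [k] stands for l = k + 1. *)
Definition H_term (u : C) (k : nat) : C := e (RtoC (half_pow (S k)) * u) - 1.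

Definition H (u : C) : C := CSeries (H_term u).

Lemma is_series_H (u : C) : is_series (H_term u) (H u).
Proof.
cut (exists l : C, is_series (H_term u) l).
{ intros [l Hl]; unfold H; now rewrite (is_series_CSeries _ _ Hl). }
apply (ex_series_C_dominated _
  (4 * PI * exp (2 * PI * Rabs (Im u)) * Cmod u)%R).
intros k; unfold H_term.
assert (Hk := half_pow_bounds k); assert (Hpi := PI_RGT_0).
assert (Hu : (- Rabs (Im u) <= Im u)%R)
  by (unfold Rabs; destruct (Rcase_abs (Im u)); lra).
assert (Hu' := Rabs_pos (Im u)).
(* Reading 1 as e(0) makes the term an increment of [e], hence of order 2^-k. *)
replace (RtoC 1) with (e (RtoC (half_pow (S k)) * 0))
  by (rewrite Cmult_0_r; apply e_0).
eapply Rle_trans.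
- apply (Cmod_e_scal_minus_le _ _ _ (Rabs (Im u)));
    change (Im 0) with 0%R; rewrite half_pow_S; nra.
- fold (half_pow k); replace (u - 0) with u by ring.
  rewrite half_pow_S.
  assert (0 < exp (2 * PI * Rabs (Im u)))%R by apply exp_pos.
  assert (0 <= Cmod u)%R by apply Cmod_ge_0.
  set (X := exp _) in *; set (Y := Cmod u) in *.
  assert (0 <= PI * X * Y * half_pow k)%R
    by (apply Rmult_le_pos; [apply Rmult_le_pos|]; nra).
  lra.
Qed.

Lemma H_0 : H 0 = 0.
Proof.
apply (is_series_C_unique (H_term 0)); [apply is_series_H|].
(* All terms vanish, so the series equals 0 times itself. *)
rewrite <- (Cmult_0_l (H 0)) at 2.
eapply is_series_C_ext; [|apply is_series_C_scal, is_series_H].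
intros k; unfold H_term; rewrite Cmult_0_r, e_0; ring.
Qed.

(** Reflection in the imaginary axis conjugates e(x u) for every real x, hence the series term by
    term; on integers it is the change of sign. *)
Lemma H_conj (u : C) : H (- Cconj u) = Cconj (H u).
Proof.
apply (is_series_C_unique (H_term (- Cconj u))); [apply is_series_H|].
eapply is_series_C_ext; [|apply is_series_C_conj, is_series_H].
intros k; unfold H_term; rewrite Cminus_conj, <- e_conj.
f_equal; [f_equal; rewrite Cmult_conj; C_coords; ring|C_coords; ring].
Qed.

Lemma H_IZR_conj (m : Z) : H (RtoC (IZR (- m))) = Cconj (H (RtoC (IZR m))).
Proof.
rewrite <- H_conj; f_equal; rewrite opp_IZR; C_coords; ring.
Qed.

(** The half plane Im >= -1 contains the discs of radius 1 around the integers, where the increments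
    of [H] are estimated later. *)
Lemma H_Lipschitz (u v : C) :
  (-1 <= Im u)%R -> (-1 <= Im v)%R ->
  (Cmod (H u - H v) <= 4 * PI * exp (2 * PI) * Cmod (u - v))%R.
Proof.
intros Hu Hv.
replace (4 * PI * exp (2 * PI) * Cmod (u - v))%R
  with (2 * (2 * PI * exp (2 * PI) * Cmod (u - v)))%R by ring.
apply (Cmod_series_dominated _ _ _
  (is_series_C_minus _ _ _ _ (is_series_H u) (is_series_H v))).
intros k; unfold H_term; fold (half_pow k).
replace (_ - 1 - (_ - 1))
  with (e (RtoC (half_pow (S k)) * u) - e (RtoC (half_pow (S k)) * v)) by ring.
assert (Hk := half_pow_bounds k).
eapply Rle_trans.
- assert (HI : forall y, (-1 <= y)%R -> (- (1) <= / 2 * half_pow k * y)%R).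
  { intros y Hy; destruct Hk as [Hk0 Hk1].
    assert (0 <= half_pow k * (y + 1))%R by (apply Rmult_le_pos; lra).
    lra. }
  apply (Cmod_e_scal_minus_le _ _ _ 1); rewrite half_pow_S;
    [lra|now apply HI|now apply HI].
- rewrite half_pow_S, Rmult_1_r; right; field.
Qed.

(** With A = e(x a) and B = e(x b): (AB - 1) - (A - 1) - (B - 1) = (A - 1)(B - 1). *)
Lemma is_series_H_defect (a b : C) :
  is_series (fun k => H_term a k * H_term b k) (H (a + b) - H a - H b).
Proof.
eapply is_series_C_ext; [|
  apply is_series_C_minus; [apply is_series_C_minus|]; apply is_series_H].
intros k; unfold H_term.
rewrite Cmult_plus_distr_l, e_plus; ring.
Qed.

(** Doubling shifts the series by one index and exposes the new first term e(u) - 1. *)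
Lemma H_double (u : C) : H (2 * u) = H u + e u - 1.
Proof.
assert (E : H (2 * u) - H_term (2 * u) 0 = H u).
{ apply (is_series_C_unique (H_term u)); [|apply is_series_H].
  eapply is_series_C_ext; [|apply is_series_C_shift, is_series_H].
  intros k; unfold H_term; now rewrite half_pow_S_double. }
rewrite <- E; unfold H_term.
rewrite half_pow_S_double; unfold half_pow; simpl; rewrite Cmult_1_l; ring.
Qed.

(** The extra terms of [H_double] cancel because [e] has period 1. *)
Lemma H_shift_double (u : C) (m : Z) :
  H (2 * u + RtoC (IZR (2 * m))) - H (2 * u) = H (u + RtoC (IZR m)) - H u.
Proof.
replace (2 * u + RtoC (IZR (2 * m))) with (2 * (u + RtoC (IZR m)))
  by (rewrite mult_IZR, RtoC_mult; ring).
rewrite !H_double, e_plus_IZR; ring.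
Qed.

Lemma H_shift_pow (k : nat) (u : C) (m : Z) :
  H (u + RtoC (IZR (2 ^ Z.of_nat k * m))) - H u
  = H (RtoC (half_pow k) * u + RtoC (IZR m)) - H (RtoC (half_pow k) * u).
Proof.
revert u; induction k as [|k IH]; intros u.
- replace (RtoC (half_pow 0) * u) with u
    by (unfold half_pow; simpl; ring).
  replace (2 ^ Z.of_nat 0 * m)%Z with m by (simpl; destruct m; reflexivity).
  reflexivity.
- rewrite Nat2Z.inj_succ, Z.pow_succ_r, <- Z.mul_assoc by lia.
  rewrite (half_double u), H_shift_double, IH, half_pow_S_double.
  reflexivity.
Qed.

(** * The periodic series F, the sum T and its relation to S *)

Lemma F_term_scal (u : C) (n : nat) : F_term u n = e (RtoC (2 ^ n) * u).
Proof. unfold F_term; now rewrite RtoC_pow. Qed.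

Lemma is_series_F (u : C) : upper_half_plane u -> is_series (F_term u) (F u).
Proof.
intros Hu; destruct (ex_series_F_term u Hu) as [l Hl].
unfold F; now rewrite (is_series_CSeries _ _ Hl).
Qed.

Lemma F_plus_IZR (u : C) (m : Z) :
  upper_half_plane u -> F (u + RtoC (IZR m)) = F u.
Proof.
intros Hu; apply is_series_CSeries.
eapply is_series_C_ext; [|now apply is_series_F].
intros n; rewrite !F_term_scal, Cmult_plus_distr_l.
replace (RtoC (2 ^ n) * RtoC (IZR m)) with (RtoC (IZR (2 ^ Z.of_nat n * m))).
- now rewrite e_plus_IZR.
- now rewrite mult_IZR, <- pow_IZR, RtoC_mult.
Qed.

Lemma upper_half_plane_scal (x : R) (u : C) :
  (0 < x)%R -> upper_half_plane u -> upper_half_plane (RtoC x * u).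
Proof.
unfold upper_half_plane; rewrite im_scal_l; apply Rmult_lt_0_compat.
Qed.

Lemma F_double (u : C) : upper_half_plane u -> F (2 * u) = F u - e u.
Proof.
intros Hu; apply is_series_CSeries.
replace (e u) with (F_term u 0)
  by (rewrite F_term_scal; simpl; f_equal; ring).
eapply is_series_C_ext; [|now apply is_series_C_shift, is_series_F].
intros n; rewrite !F_term_scal; f_equal; simpl; rewrite RtoC_mult; ring.
Qed.

Definition T (u : C) : C := F u + H u.

Lemma T_double (u : C) : upper_half_plane u -> T (2 * u) = T u - 1.
Proof. intros Hu; unfold T; rewrite F_double, H_double by assumption; ring. Qed.

(** The shift by 1 absorbs the twist of [G]: e(-1/2^l) (e((u+1)/2^l) - 1) = (e(u/2^l) - 1) -
    (e(-1/2^l) - 1). *)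
Lemma S_fun_T (u : C) :
  upper_half_plane u -> S_fun (u + 1) = T u - H (-1).
Proof.
intros Hu; unfold S_fun, T.
assert (EF := F_plus_IZR u 1 Hu); simpl in EF; rewrite EF.
cut (G (u + 1) = H u - H (-1)); [intros ->; ring|].
apply is_series_CSeries.
eapply is_series_C_ext; [|apply is_series_C_minus; apply is_series_H].
intros k; unfold H_term, G_term.
assert (E : / 2 ^ S k = RtoC (half_pow (S k))).
{ unfold half_pow; rewrite pow_inv, RtoC_inv, RtoC_pow; [reflexivity|].
  apply pow_nonzero; lra. }
unfold Cdiv; rewrite E.
replace (RtoC (half_pow (S k)) * u)
  with (RtoC (half_pow (S k)) * (-1) + (u + 1) * RtoC (half_pow (S k))) by ring.
rewrite e_plus.
replace (- (1 * RtoC (half_pow (S k)))) with (RtoC (half_pow (S k)) * (-1)) by ring.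
ring.
Qed.

(** * Almost periods *)

(* The almost periods of [T], up to the relation [T (2 * u) = T u - 1]: on
   every disc, the increment of [T] along some integer [N] is close to [s]
   modulo [Z], together with its slopes. *)
Definition almost_period (s : C) : Prop :=
  forall eps r : R, (0 < eps)%R -> (0 < r)%R ->
  exists N j : Z, forall u v : C, (Cmod u <= r)%R -> (Cmod v <= r)%R ->
    (Cmod ((H (u + RtoC (IZR N)) - H u) - (H (v + RtoC (IZR N)) - H v))
       <= eps * Cmod (u - v))%R /\
    (Cmod (H (u + RtoC (IZR N)) - H u - s - RtoC (IZR j)) <= eps)%R.

Lemma almost_period_closed (s : C) :
  (forall eps : R, (0 < eps)%R ->
     exists s' : C, almost_period s' /\ (Cmod (s - s') <= eps)%R) ->
  almost_period s.
Proof.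
intros Hs eps r Heps Hr.
destruct (Hs (eps / 2)%R) as [s' [Hs' Hd]]; [lra|].
destruct (Hs' (eps / 2)%R r) as [N [j HN]]; [lra|lra|].
exists N, j; intros u v Hu Hv; destruct (HN u v Hu Hv) as [H1 H2].
assert (H0 := Cmod_ge_0 (u - v)); split; [nra|].
replace (H (u + RtoC (IZR N)) - H u - s - RtoC (IZR j))
  with ((H (u + RtoC (IZR N)) - H u - s' - RtoC (IZR j)) - (s - s')) by ring.
eapply Rle_trans; [apply Cmod_triangle|]; rewrite Cmod_opp; lra.
Qed.

Lemma almost_period_plus (s s' : C) :
  almost_period s -> almost_period s' -> almost_period (s + s').
Proof.
intros Hs Hs' eps r Heps Hr.
destruct (Hs (eps / 2)%R r) as [N [j HN]]; [lra|lra|].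
(* The shifts are composed, so the second disc must contain the first one translated by [N]. *)
assert (HNr : (0 < r + Cmod (RtoC (IZR N)))%R)
  by (generalize (Cmod_ge_0 (RtoC (IZR N))); lra).
destruct (Hs' (eps / 2)%R _ ltac:(lra) HNr) as [N' [j' HN']].
exists (N + N')%Z, (j + j')%Z; intros u v Hu Hv.
assert (Hsh : forall w, (Cmod w <= r)%R ->
  (Cmod (w + RtoC (IZR N)) <= r + Cmod (RtoC (IZR N)))%R).
{ intros w Hw; eapply Rle_trans; [apply Cmod_triangle|lra]. }
destruct (HN u v Hu Hv) as [H1 H2].
destruct (HN' _ _ (Hsh u Hu) (Hsh v Hv)) as [H1' H2'].
rewrite !plus_IZR, !RtoC_plus, !Cplus_assoc.
set (A := H (u + RtoC (IZR N))) in *; set (B := H (v + RtoC (IZR N))) in *.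
set (A' := H (u + RtoC (IZR N) + RtoC (IZR N'))) in *.
set (B' := H (v + RtoC (IZR N) + RtoC (IZR N'))) in *.
split.
- replace (A' - H u - (B' - H v))
    with ((A' - A - (B' - B)) + (A - H u - (B - H v))) by ring.
  eapply Rle_trans; [apply Cmod_triangle|].
  replace (u + RtoC (IZR N) - (v + RtoC (IZR N))) with (u - v) in H1' by ring.
  lra.
- replace (A' - H u - (s + s') - (RtoC (IZR j) + RtoC (IZR j')))
    with ((A' - A - s' - RtoC (IZR j')) + (A - H u - s - RtoC (IZR j))) by ring.
  eapply Rle_trans; [apply Cmod_triangle|]; lra.
Qed.

Lemma almost_period_IZR (n : Z) : almost_period (RtoC (IZR n)).
Proof.
(* The zero shift works, since [j] absorbs integers. *)
intros eps r Heps Hr; exists 0%Z, (- n)%Z; intros u v _ _.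
assert (H0 := Cmod_ge_0 (u - v)).
rewrite opp_IZR, RtoC_opp, !Cplus_0_r; split.
- replace (H u - H u - (H v - H v)) with (RtoC 0) by ring.
  rewrite Cmod_0; nra.
- replace (H u - H u - RtoC (IZR n) - - RtoC (IZR n)) with (RtoC 0) by ring.
  rewrite Cmod_0; lra.
Qed.

Lemma half_pow_small (eps : R) :
  (0 < eps)%R -> exists k, (half_pow k < eps)%R.
Proof.
intros Heps; destruct (pow_lt_1_zero (/ 2)
  ltac:(rewrite Rabs_pos_eq; lra) eps Heps) as [k Hk].
exists k; specialize (Hk k (le_n k)).
fold (half_pow k) in Hk; rewrite Rabs_pos_eq in Hk; [exact Hk|].
generalize (half_pow_bounds k); lra.
Qed.

Lemma half_pow_mult_small (A eps : R) :
  (0 < eps)%R -> exists k, (A * half_pow k <= eps)%R.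
Proof.
intros Heps; assert (HA := Rabs_pos A).
destruct (half_pow_small (eps / (Rabs A + 1))) as [k Hk];
  [apply Rdiv_lt_0_compat; lra|].
exists k; assert (Hp := half_pow_bounds k).
apply Rlt_div_r in Hk; [|lra].
assert (A <= Rabs A)%R by apply Rle_abs; nra.
Qed.

(* Along [N = 2^k m] the functional equation turns the increment of [H] at [u]
   into its increment along [m] at [u / 2^k]. *)
Lemma almost_period_H (m : Z) : almost_period (H (RtoC (IZR m))).
Proof.
intros eps r Heps Hr.
(* Twice the Lipschitz constant of [H]: comparing two increments takes two differences of values of
   [H]. *)
set (L := (8 * PI * exp (2 * PI))%R).
assert (HL : (0 < L)%R)
  by (unfold L; generalize (exp_pos (2 * PI)) PI_RGT_0; intros; nra).
(* With p = 2^-k, this one product bounds [L * p] and [L * p * r] by [eps], and [p * r] by 1. *)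
destruct (half_pow_mult_small ((L + 1) * (r + 1)) (Rmin eps 1)) as [k Hk].
{ apply Rmin_pos; lra. }
assert (Hm1 := Rmin_l eps 1); assert (Hm2 := Rmin_r eps 1).
assert (Hp := half_pow_bounds k); set (p := half_pow k) in *.
assert (Hp1 : (0 <= L * p)%R) by nra.
assert (Hp2 : (0 <= p * r)%R) by nra.
assert (Hp3 : (0 <= L * p * r)%R) by nra.
assert (HK : forall u v, (Cmod u <= r)%R -> (Cmod v <= r)%R ->
  (Cmod ((H (u + RtoC (IZR (2 ^ Z.of_nat k * m))) - H u) -
         (H (v + RtoC (IZR (2 ^ Z.of_nat k * m))) - H v))
   <= L * p * Cmod (u - v))%R).
{ intros u v Hu Hv; rewrite !H_shift_pow; fold p.
  assert (HI : forall w, (Cmod w <= r)%R -> (-1 <= Im (RtoC p * w))%R).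
  { intros w Hw; rewrite im_scal_l.
    assert (HIm := Rabs_Im_le_Cmod w); apply Rabs_le_between in HIm; nra. }
  assert (HI' : forall w, (Cmod w <= r)%R ->
    (-1 <= Im (RtoC p * w + RtoC (IZR m)))%R).
  { intros w Hw; specialize (HI w Hw); revert HI.
    destruct w; unfold Im; simpl; lra. }
  assert (H1 := H_Lipschitz _ _ (HI' u Hu) (HI' v Hv)).
  assert (H2 := H_Lipschitz _ _ (HI u Hu) (HI v Hv)).
  replace (RtoC p * u + RtoC (IZR m) - (RtoC p * v + RtoC (IZR m)))
    with (RtoC p * (u - v)) in H1 by ring.
  replace (RtoC p * u - RtoC p * v) with (RtoC p * (u - v)) in H2 by ring.
  rewrite Cmod_mult, Cmod_R, Rabs_pos_eq in H1, H2 by lra.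
  set (X := H (RtoC p * u + RtoC (IZR m))) in *.
  set (Y := H (RtoC p * v + RtoC (IZR m))) in *.
  replace (X - H (RtoC p * u) - (Y - H (RtoC p * v)))
    with ((X - Y) - (H (RtoC p * u) - H (RtoC p * v))) by ring.
  eapply Rle_trans; [apply Cmod_triangle|]; rewrite Cmod_opp; unfold L; lra. }
exists (2 ^ Z.of_nat k * m)%Z, 0%Z; intros u v Hu Hv; split.
- eapply Rle_trans; [now apply HK|].
  apply Rmult_le_compat_r; [apply Cmod_ge_0|nra].
(* At 0 the increment is exactly H(m), so the value estimate is the slope estimate with [v = 0]. *)
- assert (H0 : (Cmod 0 <= r)%R) by (rewrite Cmod_0; lra).
  assert (E := H_shift_pow k 0 m).
  rewrite Cmult_0_r, H_0, Cplus_0_l in E.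
  replace (H (RtoC (IZR m))) with
    (H (0 + RtoC (IZR (2 ^ Z.of_nat k * m))) - H 0)
    by (rewrite H_0, Cplus_0_l, E; rewrite Cplus_0_l; ring).
  unfold Cminus at 1; rewrite Copp_0, Cplus_0_r.
  eapply Rle_trans; [now apply HK|].
  replace (u - 0) with u by ring; nra.
Qed.

(** * Multiples and negatives of almost periods *)

Lemma almost_period_mult_INR (n : nat) (s : C) :
  almost_period s -> almost_period (RtoC (INR n) * s).
Proof.
intros Hs; induction n as [|n IH].
- simpl INR; rewrite Cmult_0_l; apply (almost_period_IZR 0).
- rewrite S_INR, RtoC_plus, Cmult_plus_distr_r, Cmult_1_l.
  now apply almost_period_plus.
Qed.

(** The fractional parts of the multiples of [x] have a cluster point in [0, 1]; two multiples close
    to it differ by nearly an integer. *)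
Lemma recurrence_mod_Z (x eps : R) : (0 < eps)%R ->
  exists (n : nat) (p : Z), (Rabs (INR (S n) * x - IZR p) <= eps)%R.
Proof.
intros Heps.
destruct (Bolzano_Weierstrass (fun n => frac_part (INR n * x)) _
  (compact_P3 0 1)) as [l Hl].
{ intros n; destruct (base_fp (INR n * x)); lra. }
set (V := disc l (mkposreal (eps / 2) ltac:(lra))).
assert (HV : neighbourhood V l) by (eexists; intros y Hy; exact Hy).
destruct (Hl V 0%nat HV) as [a [_ Ha]].
(* Starting from [S a] forces b > a, so the multiplier b - a is positive. *)
destruct (Hl V (S a) HV) as [b [Hab Hb]].
exists (b - S a)%nat, (Int_part (INR b * x) - Int_part (INR a * x))%Z.
unfold V, disc, frac_part in Ha, Hb; simpl in Ha, Hb.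
replace (S (b - S a)) with (b - a)%nat by lia.
rewrite minus_INR, minus_IZR by lia.
apply Rabs_def2 in Ha, Hb; apply Rabs_le; lra.
Qed.

(** If (n + 1) x is close to the integer p, then -x is close to n x - p. *)
Lemma almost_period_opp_real (x : R) :
  almost_period (RtoC x) -> almost_period (RtoC (- x)).
Proof.
intros Hx; apply almost_period_closed; intros eps Heps.
destruct (recurrence_mod_Z x eps Heps) as [n [p Hp]].
exists (RtoC (INR n) * RtoC x + RtoC (IZR (- p))); split.
- apply almost_period_plus; [now apply almost_period_mult_INR|].
  apply almost_period_IZR.
- rewrite <- RtoC_mult, <- RtoC_plus, <- RtoC_minus, Cmod_R, opp_IZR.
  rewrite S_INR in Hp; rewrite <- Rabs_Ropp.
  replace (- (- x - (INR n * x + - IZR p)))%R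
    with ((INR n + 1) * x - IZR p)%R by ring.
  exact Hp.
Qed.

Lemma plus_conj_re (z : C) : z + Cconj z = RtoC (2 * Re z).
Proof. C_coords; ring. Qed.

(** For z = H(m), -z is the conjugate H(-m) minus the real almost period H(m) + H(-m). *)
Lemma almost_period_opp_H (m : Z) : almost_period (- H (RtoC (IZR m))).
Proof.
set (z := H (RtoC (IZR m))).
replace (- z) with (Cconj z + RtoC (- (2 * Re z)))
  by (rewrite RtoC_opp, <- plus_conj_re; ring).
unfold z; rewrite <- H_IZR_conj; apply almost_period_plus.
- apply almost_period_H.
- apply almost_period_opp_real; rewrite <- plus_conj_re, <- H_IZR_conj.
  apply almost_period_plus; apply almost_period_H.
Qed.

(** The natural multiples of arbitrarily short steps along [d] are dense in the ray. *)
Lemma almost_period_ray (d : C) :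
  (forall eps : R, (0 < eps)%R ->
     exists r : R, (0 < r <= eps)%R /\ almost_period (RtoC r * d)) ->
  forall t : R, (0 <= t)%R -> almost_period (RtoC t * d).
Proof.
intros Hd t Ht; apply almost_period_closed; intros eps Heps.
assert (H0 := Cmod_ge_0 d).
destruct (Hd (eps / (Cmod d + 1))%R) as [r [[Hr Hr'] Hap]];
  [apply Rdiv_lt_0_compat; lra|].
destruct (nfloor_ex (t / r)) as [n Hn].
{ apply Rdiv_le_0_compat; lra. }
exists (RtoC (INR n) * (RtoC r * d)); split;
  [now apply almost_period_mult_INR|].
replace (RtoC t * d - RtoC (INR n) * (RtoC r * d))
  with (RtoC (t - INR n * r) * d) by (rewrite RtoC_minus, RtoC_mult; ring).
destruct Hn as [Hn1 Hn2]; apply Rle_div_r in Hn1; [|lra].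
apply Rlt_div_l in Hn2; [|lra].
apply Rle_div_r in Hr'; [|lra].
rewrite Cmod_mult, Cmod_R, Rabs_pos_eq by lra; nra.
Qed.

(** * Small almost periods from the defect of additivity of H *)

Definition H_cross (n : Z) (k : nat) : C :=
  H (RtoC (IZR n) + RtoC (half_pow k)) - H (RtoC (IZR n)) - H (RtoC (half_pow k)).

(** By [H_shift_pow] at 1, the increment of [H] along n at 2^-k equals its increment along 2^k n at
    1, so only values at integers remain. *)
Lemma H_cross_IZR (n : Z) (k : nat) :
  H_cross n k = H (RtoC (IZR (1 + 2 ^ Z.of_nat k * n)))
                + - H (RtoC (IZR n)) + - H (RtoC (IZR 1)).
Proof.
assert (E := H_shift_pow k (RtoC 1) n); rewrite Cmult_1_r in E.
unfold H_cross; rewrite plus_IZR, RtoC_plus, (Cplus_comm (RtoC (IZR n))).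
replace (H (RtoC (half_pow k) + RtoC (IZR n))) with
  (H (RtoC 1 + RtoC (IZR (2 ^ Z.of_nat k * n))) - H 1 + H (RtoC (half_pow k)))
  by (rewrite E; ring).
ring.
Qed.

Lemma almost_period_H_cross (n : Z) (k : nat) :
  almost_period (H_cross n k) /\ almost_period (- H_cross n k) /\
  almost_period (Cconj (H_cross n k)) /\ almost_period (- Cconj (H_cross n k)).
Proof.
rewrite H_cross_IZR, !Cplus_conj, !Copp_conj, <- !H_IZR_conj.
assert (Hopp : forall z : C, - - z = z) by (intros; ring).
rewrite !Copp_plus_distr, !Hopp.
repeat split; repeat apply almost_period_plus;
  auto using almost_period_H, almost_period_opp_H.
Qed.

Lemma Cmod_H_cross_le (n : Z) (k : nat) :
  (Cmod (H_cross n k) <= 8 * PI * exp (2 * PI) * half_pow k)%R.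
Proof.
assert (Hp := half_pow_bounds k).
assert (H1 := H_Lipschitz (RtoC (IZR n) + RtoC (half_pow k)) (RtoC (IZR n))).
assert (H2 := H_Lipschitz (RtoC (half_pow k)) 0).
rewrite H_0 in H2.
replace (RtoC (IZR n) + RtoC (half_pow k) - RtoC (IZR n))
  with (RtoC (half_pow k)) in H1 by ring.
replace (RtoC (half_pow k) - 0) with (RtoC (half_pow k)) in H2 by ring.
rewrite Cmod_R, Rabs_pos_eq in H1, H2 by lra.
unfold H_cross.
replace (_ - _ - _) with
  (H (RtoC (IZR n) + RtoC (half_pow k)) - H (RtoC (IZR n))
   - (H (RtoC (half_pow k)) - 0)) by ring.
eapply Rle_trans; [apply Cmod_triangle|]; rewrite Cmod_opp.
unfold Im in H1, H2; simpl in H1, H2.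
specialize (H1 ltac:(lra) ltac:(lra)); specialize (H2 ltac:(lra) ltac:(lra)).
unfold Im in *; lra.
Qed.

Lemma H_term_RtoC (x : R) (j : nat) :
  H_term (RtoC x) j
  = (cos (PI * half_pow j * x) - 1, sin (PI * half_pow j * x))%R.
Proof.
unfold H_term; rewrite <- RtoC_mult, e_RtoC, half_pow_S.
replace (2 * PI * (/ 2 * half_pow j * x))%R with (PI * half_pow j * x)%R by field.
C_coords; ring.
Qed.

Lemma cross_angles (j k : nat) :
  (0 < PI * half_pow j <= PI /\ 0 < PI * half_pow j * half_pow k <= PI)%R.
Proof.
assert (Hj := half_pow_bounds j); assert (Hk := half_pow_bounds k).
assert (Hpi := PI_RGT_0).
assert (0 < half_pow j * half_pow k <= 1)%R by nra.
split; nra.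
Qed.

Lemma Re_H_cross_pos (k : nat) : (0 < Re (H_cross (-1) k))%R.
Proof.
assert (E : forall j,
  Re (H_term (RtoC (IZR (-1))) j * H_term (RtoC (half_pow k)) j)
  = ((1 - cos (PI * half_pow j)) * (1 - cos (PI * half_pow j * half_pow k))
     + sin (PI * half_pow j) * sin (PI * half_pow j * half_pow k))%R).
{ intros j; rewrite !H_term_RtoC, re_mult; unfold Re, Im; simpl fst; simpl snd.
  replace (PI * half_pow j * -1)%R with (- (PI * half_pow j))%R by ring.
  rewrite cos_neg, sin_neg; ring. }
(* At index 1 the first angle is PI/2, and the term becomes 1 - cos B + sin B with 0 < B <= PI/2. *)
eapply Rlt_le_trans; [|apply (Re_series_ge _ _ 1 (is_series_H_defect _ _))].
- destruct (cross_angles 1 k) as [HA HB]; rewrite E.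
  replace (PI * half_pow 1)%R with (PI / 2)%R in *
    by (unfold half_pow; simpl; field).
  rewrite cos_PI2, sin_PI2.
  assert (Hk := half_pow_bounds k).
  assert (0 < sin (PI / 2 * half_pow k))%R by (apply sin_gt_0; nra).
  generalize (COS_bound (PI / 2 * half_pow k)); lra.
- intros j; destruct (cross_angles j k) as [HA HB]; rewrite E.
  assert (0 <= sin (PI * half_pow j))%R by (apply sin_ge_0; lra).
  assert (0 <= sin (PI * half_pow j * half_pow k))%R by (apply sin_ge_0; lra).
  generalize (COS_bound (PI * half_pow j))
    (COS_bound (PI * half_pow j * half_pow k)); intros; nra.
Qed.

(** Since Re(i z) = - Im z, multiplying the series by i brings it under [Re_series_ge]; index 1
    again gives a positive term. *)
Lemma Im_H_cross_neg (k : nat) : (Im (H_cross 1 k) < 0)%R.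
Proof.
assert (E : forall j,
  Re (Ci * (H_term (RtoC (IZR 1)) j * H_term (RtoC (half_pow k)) j))
  = ((1 - cos (PI * half_pow j)) * sin (PI * half_pow j * half_pow k)
     + sin (PI * half_pow j) * (1 - cos (PI * half_pow j * half_pow k)))%R).
{ intros j; rewrite !H_term_RtoC, Rmult_1_r; unfold Re; simpl; ring. }
cut (0 < Re (Ci * H_cross 1 k))%R.
{ destruct (H_cross 1 k); unfold Re, Im; simpl; lra. }
eapply Rlt_le_trans;
  [|apply (Re_series_ge _ _ 1 (is_series_C_scal Ci _ _ (is_series_H_defect _ _)))].
- destruct (cross_angles 1 k) as [HA HB]; rewrite E.
  replace (PI * half_pow 1)%R with (PI / 2)%R in *
    by (unfold half_pow; simpl; field).
  rewrite cos_PI2, sin_PI2.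
  assert (Hk := half_pow_bounds k).
  assert (0 < sin (PI / 2 * half_pow k))%R by (apply sin_gt_0; nra).
  generalize (COS_bound (PI / 2 * half_pow k)); lra.
- intros j; destruct (cross_angles j k) as [HA HB]; rewrite E.
  assert (0 <= sin (PI * half_pow j))%R by (apply sin_ge_0; lra).
  assert (0 <= sin (PI * half_pow j * half_pow k))%R by (apply sin_ge_0; lra).
  generalize (COS_bound (PI * half_pow j))
    (COS_bound (PI * half_pow j * half_pow k)); intros; nra.
Qed.

(** The factor 2 anticipates the combinations of z with its conjugate, of size 2 |Re z| or 2 |Im
    z|. *)
Lemma H_cross_small (n : Z) (eps : R) : (0 < eps)%R ->
  exists k, (2 * Cmod (H_cross n k) <= eps)%R.
Proof.
intros Heps.
destruct (half_pow_mult_small (16 * PI * exp (2 * PI)) eps Heps) as [k Hk].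
exists k; generalize (Cmod_H_cross_le n k); lra.
Qed.

Lemma almost_period_real (t : R) : almost_period (RtoC t).
Proof.
assert (HS : forall eps, (0 < eps)%R -> exists r, (0 < r <= eps)%R /\
  almost_period (RtoC r) /\ almost_period (RtoC (- r))).
{ intros eps Heps; destruct (H_cross_small (-1) eps Heps) as [k Hk].
  exists (2 * Re (H_cross (-1) k))%R.
  assert (H1 := Re_H_cross_pos k); assert (H2 := re_le_Cmod (H_cross (-1) k)).
  apply Rabs_le_between in H2; split; [lra|].
  destruct (almost_period_H_cross (-1) k) as [Ha [Hb [Hc Hd]]].
  rewrite RtoC_opp, <- plus_conj_re, Copp_plus_distr.
  split; now apply almost_period_plus. }
destruct (Rle_lt_dec 0 t) as [Ht|Ht].
- replace (RtoC t) with (RtoC t * 1) by ring.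
  apply almost_period_ray; [|assumption]; intros eps Heps.
  destruct (HS eps Heps) as [r [Hr [Ha _]]]; exists r; split; [assumption|].
  now rewrite Cmult_1_r.
- replace (RtoC t) with (RtoC (- t) * - (1)) by (rewrite RtoC_opp; ring).
  apply almost_period_ray; [|lra]; intros eps Heps.
  destruct (HS eps Heps) as [r [Hr [_ Ha]]]; exists r; split; [assumption|].
  replace (RtoC r * - (1)) with (RtoC (- r)) by (rewrite RtoC_opp; ring).
  assumption.
Qed.

Lemma almost_period_imaginary (t : R) : almost_period (RtoC t * Ci).
Proof.
assert (HS : forall eps, (0 < eps)%R -> exists r, (0 < r <= eps)%R /\
  almost_period (RtoC r * Ci) /\ almost_period (RtoC r * - Ci)).
{ intros eps Heps; destruct (H_cross_small 1 eps Heps) as [k Hk].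
  exists (- (2 * Im (H_cross 1 k)))%R.
  assert (H1 := Im_H_cross_neg k); assert (H2 := Rabs_Im_le_Cmod (H_cross 1 k)).
  apply Rabs_le_between in H2; split; [lra|].
  destruct (almost_period_H_cross 1 k) as [Ha [Hb [Hc Hd]]].
  set (z := H_cross 1 k) in *; split.
  - replace (RtoC (- (2 * Im z)) * Ci) with (Cconj z + - z)
      by (C_coords; ring).
    now apply almost_period_plus.
  - replace (RtoC (- (2 * Im z)) * - Ci) with (z + - Cconj z)
      by (C_coords; ring).
    now apply almost_period_plus. }
destruct (Rle_lt_dec 0 t) as [Ht|Ht].
- apply almost_period_ray; [|assumption]; intros eps Heps.
  destruct (HS eps Heps) as [r [Hr [Ha _]]]; now exists r.
- replace (RtoC t * Ci) with (RtoC (- t) * - Ci) by (rewrite RtoC_opp; ring).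
  apply almost_period_ray; [|lra]; intros eps Heps.
  destruct (HS eps Heps) as [r [Hr [_ Ha]]]; now exists r.
Qed.

Lemma almost_period_all (s : C) : almost_period s.
Proof.
replace s with (RtoC (Re s) + RtoC (Im s) * Ci) by (C_coords; ring).
apply almost_period_plus; [apply almost_period_real|apply almost_period_imaginary].
Qed.

(** * Surjectivity *)

(** Banach iteration from the centre: a first step of at most r/2, halved each time, never leaves
    the disc. *)
Lemma contraction_fixed_point (phi : C -> C) (u0 : C) (r : R) :
  (forall u v, (Cmod (u - u0) <= r)%R -> (Cmod (v - u0) <= r)%R ->
     (Cmod (phi u - phi v) <= / 2 * Cmod (u - v))%R) ->
  (Cmod (phi u0 - u0) <= r / 2)%R ->
  exists u, (Cmod (u - u0) <= r)%R /\ phi u = u.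
Proof.
intros Hphi H0.
assert (Hr : (0 <= r)%R) by (generalize (Cmod_ge_0 (phi u0 - u0)); lra).
set (x := fun n => Nat.iter n phi u0).
assert (Hx : forall n, (Cmod (x n - u0) <= r * (1 - half_pow n))%R /\
  (Cmod (x (S n) - x n) <= r / 2 * half_pow n)%R).
{ induction n as [|n [IH1 IH2]].
  - unfold half_pow; simpl; split.
    + replace (u0 - u0) with (RtoC 0) by ring; rewrite Cmod_0; lra.
    + lra.
  - assert (Hn := half_pow_bounds n).
    assert (H1 : (Cmod (x (S n) - u0) <= r * (1 - half_pow (S n)))%R).
    { replace (x (S n) - u0) with ((x n - u0) + (x (S n) - x n)) by ring.
      eapply Rle_trans; [apply Cmod_triangle|]; rewrite half_pow_S; lra. }
    split; [exact H1|].
    change (Cmod (phi (x (S n)) - phi (x n)) <= r / 2 * half_pow (S n))%R.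
    eapply Rle_trans; [apply Hphi|]; rewrite ?half_pow_S in *; nra. }
assert (Hball : forall n, (Cmod (x n - u0) <= r)%R).
{ intros n; destruct (Hx n) as [H1 _]; assert (Hn := half_pow_bounds n); nra. }
(* Completeness enters through the telescoping series of the steps. *)
destruct (ex_series_C_dominated (fun n => x (S n) - x n) (r / 2)) as [l Hl];
  [intros n; apply Hx|].
assert (Hsum : forall n, sum_n (fun n => x (S n) - x n) n = x (S n) - u0).
{ induction n as [|n IH]; [now rewrite sum_O|].
  rewrite sum_Sn, IH.
  change (x (S n) - u0 + (x (S (S n)) - x (S n)) = x (S (S n)) - u0); ring. }
set (u := u0 + l).
assert (Hu : (Cmod (u - u0) <= r)%R).
{ replace (u - u0) with l by (unfold u; ring).
  replace r with (2 * (r / 2))%R by field.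
  apply (Cmod_series_dominated _ _ _ Hl); intros n; apply Hx. }
exists u; split; [exact Hu|].
cut (phi u - u = 0).
{ intros E; replace (phi u) with (phi u - u + u) by ring; rewrite E; ring. }
apply Cmod_eq_0, Rle_antisym; [|apply Cmod_ge_0].
apply le_epsilon; intros eps Heps.
destruct (is_series_C_approx _ _ Hl (eps / 2)%R) as [N HN]; [lra|].
assert (Hclose : forall n, (N <= n)%nat -> (Cmod (u - x (S n)) <= eps / 2)%R).
{ intros n Hn; specialize (HN n Hn); rewrite Hsum in HN.
  rewrite Cmod_minus_sym.
  replace (x (S n) - u) with (x (S n) - u0 - l) by (unfold u; ring); lra. }
assert (H1 := Hclose N (le_n N)).
assert (H2 := Hclose (S N) (le_S _ _ (le_n N))).
assert (H3 := Hphi u (x (S N)) Hu (Hball (S N))).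
change (phi (x (S N))) with (x (S (S N))) in H3.
replace (phi u - u) with ((phi u - x (S (S N))) - (u - x (S (S N)))) by ring.
eapply Rle_trans; [apply Cmod_triangle|]; rewrite Cmod_opp; lra.
Qed.

(** Newton's map with the fixed slope [a] is a contraction by 1/2, and its fixed points solve g(u) =
    z. *)
Lemma almost_linear_surjective (g : C -> C) (u0 a z : C) (r : R) :
  a <> 0 ->
  (forall u v, (Cmod (u - u0) <= r)%R -> (Cmod (v - u0) <= r)%R ->
     (Cmod (g u - g v - a * (u - v)) <= / 2 * Cmod a * Cmod (u - v))%R) ->
  (Cmod (g u0 - z) <= Cmod a * r / 2)%R ->
  exists u, (Cmod (u - u0) <= r)%R /\ g u = z.
Proof.
intros Ha Hg H0.
assert (Ha' : (0 < Cmod a)%R) by now apply Cmod_gt_0.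
assert (Hdiv : forall w, Cmod (w / a) = (Cmod w / Cmod a)%R)
  by (intros w; now apply Cmod_div).
destruct (contraction_fixed_point (fun u => u - (g u - z) / a) u0 r)
  as [u [Hu E]].
- intros u v Hu Hv.
  replace (u - (g u - z) / a - (v - (g v - z) / a))
    with (- ((g u - g v - a * (u - v)) / a)) by (field; exact Ha).
  rewrite Cmod_opp, Hdiv; apply Rle_div_l; [lra|].
  specialize (Hg u v Hu Hv); lra.
- replace (u0 - (g u0 - z) / a - u0) with (- ((g u0 - z) / a)) by (field; exact Ha).
  rewrite Cmod_opp, Hdiv; apply Rle_div_l; lra.
- exists u; split; [exact Hu|].
  replace (g u) with (z + a * (u - (u - (g u - z) / a))) by (field; exact Ha).
  rewrite E; ring.
Qed.

(** * Linearization of T near i *)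

Lemma e_scal_Ci (x : R) : e (RtoC x * Ci) = RtoC (exp (- (2 * PI * x))).
Proof.
unfold e; replace (2 * PI * Ci * (RtoC x * Ci)) with (RtoC (- (2 * PI * x)))
  by (C_coords; ring).
C_coords; rewrite ?cos_0, ?sin_0; ring.
Qed.

Lemma Im_ge_near_Ci (u : C) (r : R) :
  (Cmod (u - Ci) <= r)%R -> (1 - r <= Im u)%R.
Proof.
intros Hu; assert (HI := Rabs_Im_le_Cmod (u - Ci)).
replace (Im (u - Ci)) with (Im u - 1)%R in HI
  by (destruct u; unfold Im; simpl; ring).
assert (HA := Rle_trans _ _ _ HI Hu); apply Rabs_le_between in HA; lra.
Qed.

(* [a] is the derivative at [i]; [a / i] is a sum of positive numbers. *)
Lemma exponential_series_linearized (lam : nat -> R) (t : C -> nat -> C)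
    (f : C -> C) :
  (forall n, (0 < lam n)%R) ->
  (forall n, (lam n * exp (- (PI * lam n)) <= (/ 2) ^ n)%R) ->
  (forall n, (lam n ^ 2 * exp (- (PI * lam n)) <= (/ 2) ^ n)%R) ->
  (forall u, upper_half_plane u -> is_series (t u) (f u)) ->
  (forall u v n, t u n - t v n = e (RtoC (lam n) * u) - e (RtoC (lam n) * v)) ->
  exists a : C, (0 < Im a)%R /\
    forall (r : R) (u v : C), (r <= / 2)%R ->
      (Cmod (u - Ci) <= r)%R -> (Cmod (v - Ci) <= r)%R ->
      (Cmod (f u - f v - a * (u - v)) <= 32 * PI ^ 2 * r * Cmod (u - v))%R.
Proof.
intros Hlam H1 H2 Hf Ht; assert (Hpi := PI_RGT_0).
set (d := fun n => 2 * PI * Ci * RtoC (lam n) * e (RtoC (lam n) * Ci)).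
destruct (ex_series_C_dominated d (2 * PI)) as [a Ha].
{ intros n; unfold d; specialize (Hlam n); specialize (H1 n).
  rewrite e_scal_Ci, !Cmod_mult, Cmod_Ci, !Cmod_R, !Rabs_pos_eq
    by (try left; auto using exp_pos; lra).
  assert (HE : (exp (- (2 * PI * lam n)) <= exp (- (PI * lam n)))%R)
    by (apply exp_le; nra).
  assert (lam n * exp (- (2 * PI * lam n)) <= lam n * exp (- (PI * lam n)))%R
    by (apply Rmult_le_compat_l; lra).
  nra. }
exists a; split.
- replace (Im a) with (Re (- Ci * a)) by (destruct a; unfold Re, Im; simpl; ring).
  assert (E : forall n, (0 < Re (- Ci * d n))%R).
  { intros n; unfold d; rewrite e_scal_Ci.
    replace (Re _) with (2 * PI * lam n * exp (- (2 * PI * lam n)))%R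
      by (unfold Re; simpl; ring).
    specialize (Hlam n); generalize (exp_pos (- (2 * PI * lam n))); intros.
    apply Rmult_lt_0_compat; nra. }
  eapply Rlt_le_trans; [apply (E 0%nat)|].
  apply (Re_series_ge (fun n => - Ci * d n) _ 0); [now apply is_series_C_scal|].
  intros n; left; apply E.
- intros r u v Hr Hu Hv.
  assert (Hu' := Im_ge_near_Ci u r Hu); assert (Hv' := Im_ge_near_Ci v r Hv).
  assert (Hs := is_series_C_minus _ _ _ _
    (is_series_C_minus _ _ _ _
       (Hf u ltac:(unfold upper_half_plane; lra))
       (Hf v ltac:(unfold upper_half_plane; lra)))
    (is_series_C_scal (u - v) _ _ Ha)).
  replace (a * (u - v)) with ((u - v) * a) by ring.
  replace (32 * PI ^ 2 * r * Cmod (u - v))%R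
    with (2 * (16 * PI ^ 2 * r * Cmod (u - v)))%R by ring.
  apply (Cmod_series_dominated _ _ _ Hs); intros n; simpl; unfold d.
  (* Working with differences treats [F_term] and [H_term] alike: the constant -1 of the latter
     cancels. *)
  rewrite Ht.
  replace ((u - v) * (2 * PI * Ci * RtoC (lam n) * e (RtoC (lam n) * Ci)))
    with (2 * PI * Ci * RtoC (lam n) * e (RtoC (lam n) * Ci) * (u - v)) by ring.
  specialize (Hlam n); specialize (H2 n).
  eapply Rle_trans.
  (* As r <= 1/2, all points have imaginary part at least 1/2; hence the decay exp(-PI lam) in the
     hypotheses. *)
  + apply (Cmod_e_scal_taylor_le u v Ci (lam n) (/ 2) r); try lra.
    unfold Im; simpl; lra.
  + replace (2 * PI * / 2 * lam n)%R with (PI * lam n)%R by field.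
    assert (H0 := Cmod_ge_0 (u - v)).
    assert (Hr0 := Rle_trans _ _ _ (Cmod_ge_0 (u - Ci)) Hu).
    assert (0 <= 16 * PI ^ 2 * r * Cmod (u - v))%R
      by (assert (HP := pow2_ge_0 PI); assert (0 <= r * Cmod (u - v))%R
            by (now apply Rmult_le_pos); nra).
    replace (16 * PI ^ 2 * exp (- (PI * lam n)) * lam n ^ 2 * r * Cmod (u - v))%R
      with (16 * PI ^ 2 * r * Cmod (u - v)
            * (lam n ^ 2 * exp (- (PI * lam n))))%R by ring.
    now apply Rmult_le_compat_l.
Qed.

(** Since x <= exp x and 3 <= PI, x^3 <= exp(3x) <= exp(PI x). At x = 2^n the cube leaves a factor
    2^-n after two powers of x are spent. *)
Lemma exp_opp_le_inv_cube (x : R) : (0 < x)%R ->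
  (x ^ 3 * exp (- (PI * x)) <= 1)%R.
Proof.
intros Hx; assert (Hpi := PI2_3_2).
assert (H1 := exp_ineq1 x ltac:(lra)).
assert (H3 : (exp (3 * x) = exp x ^ 3)%R).
{ replace (3 * x)%R with (x + x + x)%R by ring; rewrite !exp_plus; ring. }
assert (H4 : (x ^ 3 <= exp x ^ 3)%R) by (apply pow_incr; lra).
assert (H5 : (exp (3 * x) <= exp (PI * x))%R) by (apply exp_le; nra).
rewrite exp_Ropp; apply Rle_div_l; [apply exp_pos|lra].
Qed.

(** The derivatives of [F] and [H] at i both have positive imaginary part, so they cannot cancel. *)
Lemma T_linearized : exists a : C, a <> 0 /\
  forall (r : R) (u v : C), (r <= / 2)%R ->
    (Cmod (u - Ci) <= r)%R -> (Cmod (v - Ci) <= r)%R ->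
    (Cmod (T u - T v - a * (u - v)) <= 64 * PI ^ 2 * r * Cmod (u - v))%R.
Proof.
assert (Hpi := PI_RGT_0).
destruct (exponential_series_linearized (fun n => 2 ^ n)%R F_term F)
  as [aF [HaF HF]].
- intros n; apply pow_lt; lra.
- intros n; assert (Hn : (1 <= 2 ^ n)%R) by (apply pow_R1_Rle; lra).
  assert (H1 := exp_opp_le_inv_cube (2 ^ n) ltac:(lra)).
  set (x := (2 ^ n)%R) in *; set (y := exp _) in *.
  assert (Hy : (0 < y)%R) by apply exp_pos.
  rewrite pow_inv; fold x; apply (Rmult_le_reg_l x); [lra|].
  rewrite Rinv_r by lra.
  assert (x ^ 2 * y <= x ^ 3 * y)%R by (apply Rmult_le_compat_r; nra); nra.
- intros n; assert (Hn : (1 <= 2 ^ n)%R) by (apply pow_R1_Rle; lra).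
  assert (H1 := exp_opp_le_inv_cube (2 ^ n) ltac:(lra)).
  set (x := (2 ^ n)%R) in *; set (y := exp _) in *.
  rewrite pow_inv; fold x; apply (Rmult_le_reg_l x); [lra|].
  rewrite Rinv_r by lra; lra.
- apply is_series_F.
- intros u v n; now rewrite !F_term_scal.
- destruct (exponential_series_linearized (fun n => half_pow (S n)) H_term H)
    as [aH [HaH HH]].
  + intros n; apply half_pow_bounds.
  + intros n; fold (half_pow n); rewrite half_pow_S.
    assert (Hn := half_pow_bounds n).
    assert (HE : (exp (- (PI * (/ 2 * half_pow n))) <= exp 0)%R)
      by (apply exp_le; nra).
    rewrite exp_0 in HE.
    generalize (exp_pos (- (PI * (/ 2 * half_pow n)))); intros; nra.
  + intros n; fold (half_pow n); rewrite half_pow_S.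
    assert (Hn := half_pow_bounds n).
    assert (HE : (exp (- (PI * (/ 2 * half_pow n))) <= exp 0)%R)
      by (apply exp_le; nra).
    rewrite exp_0 in HE.
    assert (H2 : (0 <= (/ 2 * half_pow n) ^ 2 <= half_pow n)%R) by (simpl; nra).
    generalize (exp_pos (- (PI * (/ 2 * half_pow n)))); intros; nra.
  + intros u _; apply is_series_H.
  + intros u v n; unfold H_term; ring.
  + exists (aF + aH); split.
    * intros E; assert (E' : Im (aF + aH) = 0%R) by (rewrite E; reflexivity).
      change (Im (aF + aH)) with (Im aF + Im aH)%R in E'; lra.
    * intros r u v Hr Hu Hv; unfold T.
      replace (F u + H u - (F v + H v) - (aF + aH) * (u - v))
        with ((F u - F v - aF * (u - v)) + (H u - H v - aH * (u - v))) by ring.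
      eapply Rle_trans; [apply Cmod_triangle|].
      specialize (HF r u v Hr Hu Hv); specialize (HH r u v Hr Hu Hv); lra.
Qed.

(** Doubling the argument lowers [T] by 1 and halving raises it by 1, both within the upper half
    plane. *)
Lemma T_value_plus_IZR (z : C) (j : Z) :
  (exists u, upper_half_plane u /\ T u = z + RtoC (IZR j)) ->
  exists u, upper_half_plane u /\ T u = z.
Proof.
induction j as [|j IH|j IH] using Z.peano_ind; intros [u [Hu E]].
- exists u; split; [exact Hu|]; rewrite E; apply Cplus_0_r.
- apply IH; exists (2 * u); split; [apply upper_half_plane_scal; [lra|exact Hu]|].
  rewrite T_double, E, succ_IZR, RtoC_plus by exact Hu; ring.
- apply IH; exists (RtoC (/ 2) * u).
  assert (Hu' : upper_half_plane (RtoC (/ 2) * u))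
    by (apply upper_half_plane_scal; [lra|exact Hu]).
  split; [exact Hu'|].
  assert (D := T_double _ Hu'); rewrite <- half_double, E in D.
  unfold Z.pred in D; rewrite plus_IZR, RtoC_plus in D.
  replace (T (RtoC (/ 2) * u)) with (T (RtoC (/ 2) * u) - 1 + 1) by ring.
  rewrite <- D; ring.
Qed.

Lemma T_surjective (z : C) : exists u, upper_half_plane u /\ T u = z.
Proof.
destruct T_linearized as [a [Ha HT]].
assert (Ha' : (0 < Cmod a)%R) by now apply Cmod_gt_0.
assert (HP : (0 < 64 * PI ^ 2)%R)
  by (assert (Hpi := PI_RGT_0); apply Rmult_lt_0_compat; [lra|now apply pow_lt]).
(* This radius bounds the linearization error of [T] by slope |a|/4; [eps] allows the translation
   another |a|/4 and an error |a| r/2 in the value at i. *)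
set (r := Rmin (/ 2) (Cmod a / 4 / (64 * PI ^ 2))).
assert (Hr1 : (r <= / 2)%R) by apply Rmin_l.
assert (Hr2 : (64 * PI ^ 2 * r <= Cmod a / 4)%R).
{ rewrite Rmult_comm; apply Rle_div_r; [exact HP|apply Rmin_r]. }
assert (Hr0 : (0 < r)%R).
{ apply Rmin_pos; [lra|]; repeat apply Rdiv_lt_0_compat; lra. }
set (eps := Rmin (Cmod a / 4) (Cmod a * r / 2)).
assert (He1 : (eps <= Cmod a / 4)%R) by apply Rmin_l.
assert (He2 : (eps <= Cmod a * r / 2)%R) by apply Rmin_r.
assert (He0 : (0 < eps)%R) by (apply Rmin_pos; nra).
(* This almost period carries the value at i close to z modulo the integers; radius 2 covers the
   disc around i. *)
destruct (almost_period_all (z - T Ci) eps 2 He0 ltac:(lra)) as [N [j HN]].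
assert (Hball : forall u, (Cmod (u - Ci) <= r)%R -> (Cmod u <= 2)%R).
{ intros u Hu; replace u with ((u - Ci) + Ci) by ring.
  eapply Rle_trans; [apply Cmod_triangle|]; rewrite Cmod_Ci; lra. }
apply (T_value_plus_IZR z j).
(* By periodicity of [F] the function below is T(u + N), written as a perturbation of T(u). *)
destruct (almost_linear_surjective
  (fun u => T u + (H (u + RtoC (IZR N)) - H u)) Ci a (z + RtoC (IZR j)) r Ha)
  as [u [Hu E]].
- intros u v Hu Hv.
  destruct (HN u v (Hball u Hu) (Hball v Hv)) as [H1 _].
  specialize (HT r u v Hr1 Hu Hv); assert (H0 := Cmod_ge_0 (u - v)).
  set (hu := H (u + RtoC (IZR N)) - H u) in *.
  set (hv := H (v + RtoC (IZR N)) - H v) in *.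
  replace (T u + hu - (T v + hv) - a * (u - v))
    with ((T u - T v - a * (u - v)) + (hu - hv)) by ring.
  eapply Rle_trans; [apply Cmod_triangle|]; nra.
- assert (HCi : (Cmod Ci <= 2)%R) by (rewrite Cmod_Ci; lra).
  destruct (HN Ci Ci HCi HCi) as [_ H2].
  replace (_ - _) with
    (H (Ci + RtoC (IZR N)) - H Ci - (z - T Ci) - RtoC (IZR j)) by ring.
  lra.
- assert (Hu' : upper_half_plane u).
  { unfold upper_half_plane; assert (HI := Im_ge_near_Ci u r Hu); lra. }
  exists (u + RtoC (IZR N)); split.
  + revert Hu'; unfold upper_half_plane; destruct u; unfold Im; simpl; lra.
  + rewrite <- E; unfold T; rewrite F_plus_IZR by exact Hu'; ring.
Qed.

Theorem theorem1p3 :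
  forall z : C, exists w : C, upper_half_plane w /\ S_fun w = z.
Proof.
intros z; destruct (T_surjective (z + H (-1))) as [u [Hu E]].
exists (u + 1); split.
- revert Hu; unfold upper_half_plane; destruct u; unfold Im; simpl; lra.
- rewrite S_fun_T, E by exact Hu; ring.
Qed.
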